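(* On $A=M_2(\mathbb{C})$ with its standard 2D calculus, quantum metric $g=\imath(s^2\otimes s^1-s^1\otimes s^2)$, quantum Levi-Civita connection $\nabla s^i=2\vartheta\otimes s^i$, and spinor data ($\epsilon'=\pm1$) $$C^1=\tfrac{1}{\sqrt2}\sigma^1,\quad C^2=\tfrac{\epsilon'}{\sqrt2}\sigma^3,\quad S_1=\tfrac{\imath}{2}\sigma^1\begin{pmatrix}1&\epsilon'\\-\epsilon'&1\end{pmatrix},\quad S_2=\tfrac{\imath}{2}\sigma^2\begin{pmatrix}1&-\epsilon'\\\epsilon'&1\end{pmatrix},$$ so that $$({\not\!D}\psi)_\beta=\frac{\imath}{2\sqrt2}\Big((\sigma^1\psi_\alpha+\psi_\alpha\sigma^2)\,\sigma^{1\,\alpha}{}_\beta+\epsilon'(\psi_\alpha\sigma^1+\sigma^2\psi_\alpha)\,\sigma^{3\,\alpha}{}_\beta\Big),$$ one has $$({\not\!D}^2\psi)_\beta=-\tfrac12\psi_\beta-\tfrac14(\sigma^1\psi_\beta\sigma^2+\sigma^2\psi_\beta\sigma^1)+\tfrac{\epsilon'}{4}\{\sigma^3,\psi_\alpha\}\,\sigma^{2\,\alpha}{}_\beta,\qquad \varphi^\alpha{}_\beta=-2\epsilon'\sigma^{2\,\alpha}{}_\beta,$$ $$(\square_{\mathcal S}\psi)_\beta=-\tfrac12\{\sigma^3,\psi_\beta\}+\tfrac{\epsilon'}{2}(\sigma^2\psi_\alpha\sigma^1+\sigma^1\psi_\alpha\sigma^2)\,\sigma^{2\,\alpha}{}_\beta,\qquad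 R_{\mathcal S}{}^\alpha{}_\beta=\epsilon'\sigma^{2\,\alpha}{}_\beta$$ and $\kappa=1$, in agreement with the Lichnerowicz formula $$({\not\!D}^2\psi)_\alpha\varphi^\alpha{}_\beta=\kappa(\square_{\mathcal S}\psi)_\beta+\psi_\alpha R_{\mathcal S}{}^\alpha{}_\beta .$$ Here Pauli matrices without spinor indices are elements of $A$ and those with indices ${}^\alpha{}_\beta$ act on spinor indices.
   Context: **Calculus and QRG.** $\Omega^1(M_2(\mathbb{C}))$ is free with central self-adjoint basis $s^1,s^2$; with Pauli matrices $\sigma^1=\begin{pmatrix}0&1\\1&0\end{pmatrix}$, $\sigma^2=\begin{pmatrix}0&-\imath\\\imath&0\end{pmatrix}$, $\sigma^3=\begin{pmatrix}1&0\\0&-1\end{pmatrix}$ in $A$, it is inner with $da=[\vartheta,a]$, $\vartheta=\frac{\imath}{2}(\sigma^1s^1+\sigma^2s^2)$, so $da=(\partial_ia)s^i$, $\partial_i=\frac{\imath}{2}[\sigma^i,\ ]$. Exterior algebra: $s^1\wedge s^1=s^2\wedge s^2=\imath\mathrm{Vol}$, $s^1\wedge s^2=s^2\wedge s^1=0$, $ds^i=-\sigma^i\mathrm{Vol}$, with $\mathrm{Vol}$ a central basis of $\Omega^2$. Inverse metric $(\ ,\ ):\Omega^1\otimes_A\Omega^1\to A$ is the bimodule map with $g^{ij}:=(s^i,s^j)$, $g^{12}=-\imath=-g^{21}$, $g^{11}=g^{22}=0$. The connection $\nabla$ obeys $\nabla(a\omega)=a\nabla\omega+da\otimes\omega$,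 $\nabla(\omega a)=(\nabla\omega)a+\sigma(\omega\otimes da)$ with bimodule map $\sigma(s^i\otimes s^j)=-s^j\otimes s^i$. **Spinors.** $\mathcal S$ is free with central basis $e^1,e^2$; $\psi=\psi_\alpha e^\alpha$, $\psi_\alpha\in A$. Clifford action: bimodule map $s^i\triangleright e^\alpha=C^{i\alpha}{}_\beta e^\beta$. Spinor connection: $\nabla_{\mathcal S}e^\alpha=S^\alpha{}_{i\beta}s^i\otimes e^\beta$, $\nabla_{\mathcal S}(a\psi)=a\nabla_{\mathcal S}\psi+da\otimes\psi$. Matrices have row index $\alpha$ and column index $\beta$; in $S_1,S_2$ the factor $\sigma^i$ is in $A$ and the displayed matrix is in spinor indices. ${\not\!D}=\triangleright\circ\nabla_{\mathcal S}$. **Clifford relations.** $\varphi(e^\alpha)=\varphi^\alpha{}_\beta e^\beta$ is the bimodule automorphism (unique once $\kappa=1$ is fixed) such that $(s^i\wedge s^j)\triangleright e^\alpha:=C^{j\alpha}{}_\beta C^{i\beta}{}_\gamma\varphi^\gamma{}_\delta e^\delta-\kappa g^{ij}e^\alpha$ is well defined on $\Omega^2\otimes_A\mathcal S$. **Spinor Laplacian and curvature.** $\square_{\mathcal S}=((\ ,\ )\otimes\mathrm{id})\big(\nabla\otimes\mathrm{id}+(\sigma\otimes\mathrm{id})(\mathrm{id}\otimes\nabla_{\mathcal S})\big)\nabla_{\mathcal S}$; $R_{\mathcal S}=(d\otimes\mathrm{id}-\mathrm{id}\wedge\nabla_{\mathcal S})\nabla_{\mathcal S}:\mathcal S\to\Omega^2\otimes_A\mathcal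 S$; its coefficients are defined by $(\triangleright\circ R_{\mathcal S})(e^\alpha)=R_{\mathcal S}{}^\alpha{}_\beta e^\beta$. *)

(* Defs.v *)
From HB Require Import structures.
From mathcomp Require Import all_boot all_order all_algebra ring.

Set Implicit Arguments.
Unset Strict Implicit.
Unset Printing Implicit Defensive.

Import Order.TTheory GRing.Theory Num.Theory.

Local Open Scope ring_scope.

(* Bimodules over A = M_2(C) that are free on a finite central basis.        *)
(* An element of [freeb C I] is the family of its coefficients in the basis  *)
(* indexed by I.  The basis being central, both actions are componentwise,   *)
(* and the tensor product over A of the bimodules free on I and on J is free *)
(* on I * J (lemma [tlift_universal] gives its universal property).          *)

Notation alg C := ('M[C]_2).
Notation freeb C I := {ffun I -> alg C}.

Section FreeBimodules.
Variable C : numClosedFieldType.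
Implicit Types I J K : finType.

Definition lact I (a : alg C) (m : freeb C I) : freeb C I :=
  [ffun k => a * m k].

Definition ract I (m : freeb C I) (a : alg C) : freeb C I :=
  [ffun k => m k * a].

Definition bvec I (k : I) : freeb C I := [ffun l => (k == l)%:R].

Definition tens I J (m : freeb C I) (n : freeb C J) : freeb C (I * J)%type :=
  [ffun p => m p.1 * n p.2].

Definition assocl I J K (X : freeb C (I * (J * K))%type) :
    freeb C (I * J * K)%type :=
  [ffun p => X (p.1.1, (p.1.2, p.2))].

(* The left A-linear map with prescribed values on the basis. *)
Definition lext I (V : finType) (F : I -> freeb C V) (m : freeb C I) :
    freeb C V :=
  \sum_k lact (m k) (F k).

Definition bimodule_map I J (f : freeb C I -> freeb C J) : Prop :=
  [/\ forall m n, f (m + n) = f m + f n,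
      forall a m, f (lact a m) = lact a (f m) &
      forall a m, f (ract m a) = ract (f m) a].

Definition bimodule_automorphism I (f : freeb C I -> freeb C I) : Prop :=
  bimodule_map f /\ bijective f.

Definition balanced I J (V : zmodType) (f : freeb C I -> freeb C J -> V) :
    Prop :=
  [/\ forall m1 m2 n, f (m1 + m2) n = f m1 n + f m2 n,
      forall m n1 n2, f m (n1 + n2) = f m n1 + f m n2 &
      forall m a n, f (ract m a) n = f m (lact a n)].

Definition slice I J (X : freeb C (I * J)%type) (j : J) : freeb C I :=
  [ffun i => X (i, j)].

(* For a balanced f, the additive map on the tensor product over A sending   *)
(* m (x) n to f m n; see [tliftE] and [tlift_universal].                      *)
Definition tlift I J (V : zmodType) (f : freeb C I -> freeb C J -> V)
    (X : freeb C (I * J)%type) : V :=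
  \sum_j f (slice X j) (bvec j).

(* f (x) id, for a right A-linear f. *)
Definition tmapl I J K (f : freeb C I -> freeb C J) :
    freeb C (I * K)%type -> freeb C (J * K)%type :=
  tlift (fun m n => tens (f m) n).

Lemma freebD I (m n : freeb C I) k : (m + n) k = m k + n k.
Proof. exact: ffunE. Qed.

Lemma freebN I (m : freeb C I) k : (- m) k = - m k.
Proof. exact: ffunE. Qed.

Lemma freebZ I c (m : freeb C I) k : (c *: m) k = c *: m k.
Proof. exact: ffunE. Qed.

Lemma bvecE I (k l : I) : bvec k l = (k == l)%:R.
Proof. exact: ffunE. Qed.

Lemma lactE I a (m : freeb C I) k : lact a m k = a * m k.
Proof. exact: ffunE. Qed.

Lemma ractE I (m : freeb C I) a k : ract m a k = m k * a.
Proof. exact: ffunE. Qed.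

Lemma tensE I J (m : freeb C I) (n : freeb C J) i j :
  tens m n (i, j) = m i * n j.
Proof. exact: ffunE. Qed.

Lemma lactDl I a b (m : freeb C I) : lact (a + b) m = lact a m + lact b m.
Proof. by apply/ffunP => k; rewrite !ffunE mulrDl. Qed.

Lemma lactDr I a (m n : freeb C I) : lact a (m + n) = lact a m + lact a n.
Proof. by apply/ffunP => k; rewrite !ffunE mulrDr. Qed.

Lemma ractDl I a (m n : freeb C I) : ract (m + n) a = ract m a + ract n a.
Proof. by apply/ffunP => k; rewrite !ffunE mulrDl. Qed.

Lemma lactA I a b (m : freeb C I) : lact a (lact b m) = lact (a * b) m.
Proof. by apply/ffunP => k; rewrite !ffunE mulrA. Qed.

Lemma lactN I a (m : freeb C I) : lact a (- m) = - lact a m.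
Proof. by apply/ffunP => k; rewrite !ffunE mulrN. Qed.

Lemma lact0 I a : lact a 0 = 0 :> freeb C I.
Proof. by apply/ffunP => k; rewrite !ffunE mulr0. Qed.

Lemma lact0l I (m : freeb C I) : lact 0 m = 0.
Proof. by apply/ffunP => k; rewrite !ffunE mul0r. Qed.

Lemma lact1 I (m : freeb C I) : lact 1 m = m.
Proof. by apply/ffunP => k; rewrite !ffunE mul1r. Qed.

Lemma lact_sum I a (T : finType) (F : T -> freeb C I) :
  lact a (\sum_t F t) = \sum_t lact a (F t).
Proof. by apply: (big_morph (lact a)); [exact: lactDr | exact: lact0]. Qed.

Lemma bvec_central I a (k : I) : lact a (bvec k) = ract (bvec k) a.
Proof.
by apply/ffunP => l; rewrite !ffunE; case: eqP; rewrite ?(mulr0, mul0r, mulr1, mul1r).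
Qed.

Lemma bvec_decomp I (m : freeb C I) : m = \sum_k lact (m k) (bvec k).
Proof.
apply/ffunP => l; rewrite sum_ffunE (bigD1 l) //= !ffunE eqxx mulr1.
by rewrite big1 ?addr0 // => k /negbTE nkl; rewrite !ffunE nkl mulr0.
Qed.

Lemma tensDl I J (m1 m2 : freeb C I) (n : freeb C J) :
  tens (m1 + m2) n = tens m1 n + tens m2 n.
Proof. by apply/ffunP => k; rewrite !ffunE mulrDl. Qed.

Lemma tensDr I J (m : freeb C I) (n1 n2 : freeb C J) :
  tens m (n1 + n2) = tens m n1 + tens m n2.
Proof. by apply/ffunP => k; rewrite !ffunE mulrDr. Qed.

Lemma tens_ract I J (m : freeb C I) a (n : freeb C J) :
  tens (ract m a) n = tens m (lact a n).
Proof. by apply/ffunP => k; rewrite !ffunE mulrA. Qed.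

Lemma tens_lact I J (m : freeb C I) a (n : freeb C J) :
  tens (lact a m) n = lact a (tens m n).
Proof. by apply/ffunP => k; rewrite !ffunE mulrA. Qed.

Lemma balanced_tens I J : balanced (@tens I J).
Proof. by split; [exact: tensDl | exact: tensDr | exact: tens_ract]. Qed.

Lemma assocl_tens I J K (m : freeb C I) (n : freeb C J) (p : freeb C K) :
  assocl (tens m (tens n p)) = tens (tens m n) p.
Proof. by apply/ffunP => k; rewrite !ffunE /= mulrA. Qed.

Lemma assoclD I J K (X Y : freeb C (I * (J * K))%type) :
  assocl (X + Y) = assocl X + assocl Y.
Proof. by apply/ffunP => k; rewrite !ffunE. Qed.

Lemma slice_tens I J (m : freeb C I) (n : freeb C J) j :
  slice (tens m n) j = ract m (n j).
Proof. by apply/ffunP => k; rewrite !ffunE. Qed.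

Lemma slice_decomp I J (X : freeb C (I * J)%type) :
  X = \sum_j tens (slice X j) (bvec j).
Proof.
apply/ffunP => -[i l]; rewrite sum_ffunE (bigD1 l) //= !ffunE eqxx mulr1.
by rewrite big1 ?addr0 // => k /negbTE nkl; rewrite !ffunE nkl mulr0.
Qed.

Lemma balanced_sumr I J (V : zmodType) (f : freeb C I -> freeb C J -> V) :
  balanced f -> forall m (T : finType) (F : T -> freeb C J),
  f m (\sum_t F t) = \sum_t f m (F t).
Proof.
move=> [_ fDr _] m T F; apply: (big_morph (f m)) => //.
by apply: (addrI (f m 0)); rewrite -fDr !addr0.
Qed.

Lemma tliftD I J (V : zmodType) (f : freeb C I -> freeb C J -> V) :
  balanced f -> forall X Y, tlift f (X + Y) = tlift f X + tlift f Y.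
Proof.
move=> [fDl _ _] X Y; rewrite -big_split; apply: eq_bigr => j _ /=.
by rewrite -fDl; congr (f _ _); apply/ffunP => k; rewrite !ffunE.
Qed.

Lemma tliftE I J (V : zmodType) (f : freeb C I -> freeb C J -> V) :
  balanced f -> forall m n, tlift f (tens m n) = f m n.
Proof.
move=> fb m n; rewrite [in RHS](bvec_decomp n) (balanced_sumr fb).
by case: fb => _ _ fA; apply: eq_bigr => j _; rewrite slice_tens fA.
Qed.

Lemma tmapl_balanced I J K (f : freeb C I -> freeb C J) :
  bimodule_map f -> balanced (fun m (n : freeb C K) => tens (f m) n).
Proof.
move=> [fD _ fr]; split=> [m1 m2 n|m n1 n2|m a n].
- by rewrite fD tensDl.
- exact: tensDr.
- by rewrite fr tens_ract.
Qed.

Lemma tmapl_tens I J K (f : freeb C I -> freeb C J) :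
  bimodule_map f -> forall m (n : freeb C K), tmapl f (tens m n) = tens (f m) n.
Proof. by move=> fb m n; rewrite /tmapl tliftE //; exact: tmapl_balanced. Qed.

Lemma tmaplE I J K (f : freeb C I -> freeb C J) (X : freeb C (I * K)%type) p k :
  tmapl f X (p, k) = f (slice X k) p.
Proof.
rewrite /tmapl /tlift sum_ffunE (bigD1 k) //= tensE bvecE eqxx mulr1.
rewrite big1 ?addr0 // => l /negbTE nlk.
by rewrite tensE bvecE nlk mulr0.
Qed.

Lemma assoclE I J K (X : freeb C (I * (J * K))%type) i j k :
  assocl X (i, j, k) = X (i, (j, k)).
Proof. exact: ffunE. Qed.

Lemma sliceE I J (X : freeb C (I * J)%type) i j : slice X j i = X (i, j).
Proof. exact: ffunE. Qed.

Lemma tlift_universal I J (V : zmodType) (f : freeb C I -> freeb C J -> V) :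
  balanced f -> forall F : freeb C (I * J)%type -> V,
  (forall X Y, F (X + Y) = F X + F Y) ->
  (forall m n, F (tens m n) = f m n) -> F =1 tlift f.
Proof.
move=> fb F FD FE X; rewrite [in LHS](slice_decomp X).
rewrite (big_morph F (id1 := 0) (op1 := +%R)) //.
  by apply: eq_bigr => j _; rewrite FE.
by apply: (addrI (F 0)); rewrite -FD !addr0.
Qed.

End FreeBimodules.

Section Calculus.
Variable C : numClosedFieldType.

Definition mx22 (a b c d : C) : 'M[C]_2 :=
  \matrix_(i, j) if i == 0 then (if j == 0 then a else b)
                 else (if j == 0 then c else d).

Definition pauli1 : 'M[C]_2 := mx22 0 1 1 0.
Definition pauli2 : 'M[C]_2 := mx22 0 (- 'i) 'i 0.
Definition pauli3 : 'M[C]_2 := mx22 1 0 0 (-1).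

(* The index of s^1, e^1, sigma^1 is 0 : 'I_2, that of s^2, e^2, sigma^2 is 1. *)
Definition pauli (i : 'I_2) : alg C := if i == 0 then pauli1 else pauli2.

Notation Omega1 := (freeb C 'I_2).
Notation Omega2 := (freeb C unit).

Definition s_ (i : 'I_2) : Omega1 := bvec C i.
Definition Vol : Omega2 := bvec C tt.

Definition theta : Omega1 := \sum_i ('i / 2) *: lact (pauli i) (s_ i).

Definition d0 (a : alg C) : Omega1 := ract theta a - lact a theta.

Definition wedge : freeb C ('I_2 * 'I_2)%type -> Omega2 :=
  lext (fun p => if p.1 == p.2 then 'i *: Vol else 0).

Definition ds (i : 'I_2) : Omega2 := - lact (pauli i) Vol.

(* d(a s^i) = da /\ s^i + a ds^i *)
Definition d1 (w : Omega1) : Omega2 :=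
  \sum_i (wedge (tens (d0 (w i)) (s_ i)) + lact (w i) (ds i)).

Definition qmetric : freeb C ('I_2 * 'I_2)%type :=
  'i *: (tens (s_ 1) (s_ 0) - tens (s_ 0) (s_ 1)).

(* g^{ij} = (s^i, s^j) *)
Definition gup (i j : 'I_2) : C := mx22 0 (- 'i) 'i 0 i j.

Definition inv_metric (X : freeb C ('I_2 * 'I_2)%type) : alg C :=
  \sum_i \sum_j gup i j *: X (i, j).

(* nabla s^i = 2 theta (x) s^i, extended by the left Leibniz rule *)
Definition nabla (w : Omega1) : freeb C ('I_2 * 'I_2)%type :=
  \sum_i (lact (w i) (tens (2 *: theta) (s_ i)) + tens (d0 (w i)) (s_ i)).

Definition braid : freeb C ('I_2 * 'I_2)%type -> freeb C ('I_2 * 'I_2)%type :=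
  lext (fun p => - tens (s_ p.2) (s_ p.1)).

Definition left_connection (J : finType)
    (N : freeb C J -> freeb C ('I_2 * J)%type) : Prop :=
  (forall m n, N (m + n) = N m + N n) /\
  (forall a m, N (lact a m) = lact a (N m) + tens (d0 a) m).

(* nabla (x) id + (sigma (x) id)(id (x) N), for N a left connection. *)
Definition tens_conn (J : finType)
    (N : freeb C J -> freeb C ('I_2 * J)%type) :
    freeb C ('I_2 * J)%type -> freeb C ('I_2 * 'I_2 * J)%type :=
  tlift (fun w m => tens (nabla w) m + tmapl braid (assocl (tens w (N m)))).

(* d (x) id - id /\ N, for N a left connection. *)
Definition tens_curv (J : finType)
    (N : freeb C J -> freeb C ('I_2 * J)%type) :
    freeb C ('I_2 * J)%type -> freeb C (unit * J)%type :=
  tlift (fun w m => tens (d1 w) m - tmapl wedge (assocl (tens w (N m)))).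

Lemma mx22_eta (A : 'M[C]_2) : A = mx22 (A 0 0) (A 0 1) (A 1 0) (A 1 1).
Proof.
apply/matrixP => i j; rewrite mxE.
by case: i j => [[|[|//]] p] [[|[|//]] q]; rewrite /=;
  congr (A _ _); apply: val_inj.
Qed.

Lemma mx22D a b c d a' b' c' d' :
  mx22 a b c d + mx22 a' b' c' d' = mx22 (a + a') (b + b') (c + c') (d + d').
Proof. by apply/matrixP => i j; rewrite !mxE; do 2 case: ifP. Qed.

Lemma mx22N a b c d : - mx22 a b c d = mx22 (- a) (- b) (- c) (- d).
Proof. by apply/matrixP => i j; rewrite !mxE; do 2 case: ifP. Qed.

Lemma mx22Z k a b c d : k *: mx22 a b c d = mx22 (k * a) (k * b) (k * c) (k * d).
Proof. by apply/matrixP => i j; rewrite !mxE; do 2 case: ifP. Qed.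

Lemma mx22M a b c d a' b' c' d' : mx22 a b c d * mx22 a' b' c' d' =
  mx22 (a * a' + b * c') (a * b' + b * d') (c * a' + d * c') (c * b' + d * d').
Proof.
apply/matrixP => i j; rewrite !mxE !big_ord_recl big_ord0 !mxE /= addr0.
by do 2 case: ifP.
Qed.

Lemma mx22_0 : 0 = mx22 0 0 0 0.
Proof. by apply/matrixP => i j; rewrite !mxE; do 2 case: ifP. Qed.

Lemma mx22_1 : 1 = mx22 1 0 0 1.
Proof.
apply/matrixP => i j; rewrite !mxE.
by case: i j => [[|[|//]] p] [[|[|//]] q].
Qed.

Definition mx22E := (mx22D, mx22N, mx22Z, mx22M, mx22_0, mx22_1).

Lemma sum2 (V : zmodType) (F : 'I_2 -> V) : \sum_i F i = F 0 + F 1.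
Proof.
by rewrite !big_ord_recl big_ord0 addr0; congr (_ + F _); apply: val_inj.
Qed.

Lemma sum22 (V : zmodType) (F : 'I_2 * 'I_2 -> V) :
  \sum_p F p = F (0, 0) + F (0, 1) + (F (1, 0) + F (1, 1)).
Proof.
transitivity (\sum_i \sum_j F (i, j)); last by rewrite !sum2.
by rewrite pair_bigA; apply: eq_bigr => -[].
Qed.

Lemma ord2P (P : 'I_2 -> Prop) : P 0 -> P 1 -> forall i, P i.
Proof.
by move=> P0 P1 [[|[|//]] p]; [move: P0 | move: P1]; congr P; apply: val_inj.
Qed.

Lemma lext_bimodule (I J : finType) (F : I -> freeb C J) :
  (forall a k, lact a (F k) = ract (F k) a) -> bimodule_map (lext F).
Proof.
move=> Fc; split=> [m n|a m|a m].
- by rewrite -big_split; apply: eq_bigr => k _; rewrite ffunE lactDl.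
- by rewrite lact_sum; apply: eq_bigr => k _; rewrite ffunE lactA.
- apply/ffunP => l; rewrite /lext ffunE !sum_ffunE mulr_suml.
  apply: eq_bigr => k _; rewrite !ffunE -!mulrA; congr (_ * _).
  by have /ffunP/(_ l) := Fc a k; rewrite !ffunE.
Qed.

Lemma lext_bvec (I J : finType) (F : I -> freeb C J) k : lext F (bvec C k) = F k.
Proof.
rewrite /lext (bigD1 k) //= ffunE eqxx lact1 big1 ?addr0 // => l /negbTE nlk.
by rewrite ffunE eq_sym nlk lact0l.
Qed.

Lemma thetaE i : theta i = ('i / 2) *: pauli i.
Proof.
rewrite sum_ffunE (bigD1 i) //= !ffunE eqxx mulr1.
by rewrite big1 ?addr0 // => k /negbTE nki; rewrite !ffunE nki mulr0 scaler0.
Qed.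

Lemma d0E a i : d0 a i = theta i * a - a * theta i.
Proof. by rewrite !ffunE. Qed.

Lemma d0_partial a i : d0 a i = ('i / 2) *: (pauli i * a - a * pauli i).
Proof. by rewrite d0E thetaE -scalerAl -scalerAr scalerBr. Qed.

Lemma d0D a b : d0 (a + b) = d0 a + d0 b.
Proof.
by apply/ffunP => i; rewrite [RHS]ffunE !d0E mulrDr mulrDl opprD addrACA.
Qed.

Lemma d0M a b : d0 (a * b) = ract (d0 a) b + lact a (d0 b).
Proof.
apply/ffunP => i; rewrite [RHS]ffunE ractE lactE !d0E mulrBl mulrBr !mulrA.
by rewrite addrA subrK.
Qed.

Lemma d0ME a b i : d0 (a * b) i = d0 a i * b + a * d0 b i.
Proof. by rewrite d0M freebD ractE lactE. Qed.

Lemma wedge_bimodule : bimodule_map wedge.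
Proof.
apply: lext_bimodule => a p; case: ifP => _; apply/ffunP => k.
  by rewrite !ffunE -scalerAl -scalerAr; case: eqP; rewrite ?mulr1 ?mul1r ?mulr0 ?mul0r.
by rewrite !ffunE mul0r mulr0.
Qed.

Lemma wedge_basis i j :
  wedge (tens (s_ i) (s_ j)) = if i == j then 'i *: Vol else 0.
Proof.
have -> : tens (s_ i) (s_ j) = bvec C (i, j).
  apply/ffunP => p; rewrite !ffunE -[(i, j) == p]/((i == p.1) && (j == p.2)).
  by do 2 case: eqP; rewrite ?mulr1 ?mulr0.
exact: lext_bvec.
Qed.

Lemma wedgeE X : wedge X tt = 'i *: (X (0, 0) + X (1, 1)).
Proof.
rewrite /wedge /lext sum_ffunE.
rewrite sum22 /= !lactE /Vol !ffunE !mulr0 addr0 add0r /=.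
by rewrite -!scalerAr !mulr1 scalerDr.
Qed.

Lemma d1E w : d1 w tt =
  'i *: (d0 (w 0) 0 + d0 (w 1) 1) - (w 0 * pauli 0 + w 1 * pauli 1).
Proof.
rewrite /d1 sum2; move: (d0 (w 0)) (d0 (w 1)) => a b.
rewrite !freebD !wedgeE !tensE !lactE /ds !freebN !lactE !bvecE /=.
rewrite !(mulr1, mulr0, addr0, add0r).
by rewrite !mulrN scalerDr opprD addrACA.
Qed.

Lemma braidE X i j : braid X (i, j) = - X (j, i).
Proof.
rewrite /braid /lext sum_ffunE sum22 !lactE !freebN /= !tensE !bvecE.
elim/ord2P: i; elim/ord2P: j; rewrite /= !(mulr1, mulr0, mul0r, mulrN);
by rewrite !(oppr0, mulr0, addr0, add0r).
Qed.

Lemma nablaE w i j : nabla w (i, j) = 2 *: (w j * theta i) + d0 (w j) i.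
Proof.
elim/ord2P: j; rewrite /nabla sum2;
move: (d0 (w 0)) (d0 (w 1)) theta => a b t;
rewrite !freebD !lactE !tensE !freebZ !bvecE /= !(mulr1, mulr0, addr0, add0r);
by rewrite -scalerAr.
Qed.

Lemma inv_metricE X : inv_metric X = 'i *: (X (1, 0) - X (0, 1)).
Proof.
rewrite /inv_metric !sum2 /gup !mxE /= !scale0r add0r addr0 addrC.
by rewrite scaleNr scalerBr.
Qed.

Lemma i2 : 'i * 'i = -1 :> C. Proof. by rewrite -expr2 sqrCi. Qed.

Lemma nz2 : 2 != 0 :> C. Proof. by rewrite pnatr_eq0. Qed.

Lemma mx22_ind (P : alg C -> Prop) :
  (forall a b c d, P (mx22 a b c d)) -> forall A, P A.
Proof. by move=> PM A; rewrite (mx22_eta A). Qed.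

Lemma d1_d0 a : d1 (d0 a) = 0.
Proof.
apply/ffunP => -[]; rewrite d1E !d0E !thetaE /pauli /= ffunE /pauli1 /pauli2.
elim/mx22_ind: a => a b c d; rewrite !mx22E.
have h := i2; have z := nz2; congr mx22; field: h => //.
Qed.

Lemma d1_bvec i : d1 (s_ i) = ds i.
Proof.
apply/ffunP => -[]; rewrite d1E !bvecE freebN lactE bvecE mulr1 !d0E.
elim/ord2P: i => /=; rewrite !(mulr1, mulr0, mul1r, mul0r, subrr, oppr0);
by rewrite !(addr0, add0r, scaler0).
Qed.

Lemma d1_lact a w : d1 (lact a w) = wedge (tens (d0 a) w) + lact a (d1 w).
Proof.
apply/ffunP => -[]; rewrite [RHS]freebD wedgeE !tensE lactE !d1E !lactE !d0ME.
move: (d0 a 0) (d0 a 1) (d0 (w 0) 0) (d0 (w 1) 1) => x y z t.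
rewrite mulrBr -scalerAr mulrDr mulrDr !mulrA addrACA scalerDr.
by rewrite -!addrA.
Qed.

Lemma d1_ract w a : d1 (ract w a) = ract (d1 w) a - wedge (tens w (d0 a)).
Proof.
apply/ffunP => -[]; rewrite [RHS]freebD freebN wedgeE !tensE ractE !d1E !ractE.
rewrite !d0E !thetaE /pauli /=; move: (w 0) (w 1) => u v.
elim/mx22_ind: u => u1 u2 u3 u4; elim/mx22_ind: v => v1 v2 v3 v4.
elim/mx22_ind: a => a b c d; rewrite /pauli1 /pauli2 !mx22E.
have h := i2; have z := nz2; congr mx22; field: h => //.
Qed.

Lemma inv_metric_lact a X : inv_metric (lact a X) = a * inv_metric X.
Proof. by rewrite !inv_metricE !lactE -mulrBr -scalerAr. Qed.

Lemma inv_metric_ract X a : inv_metric (ract X a) = inv_metric X * a.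
Proof. by rewrite !inv_metricE !ractE -mulrBl -scalerAl. Qed.

Lemma inv_metricD X Y : inv_metric (X + Y) = inv_metric X + inv_metric Y.
Proof. by rewrite !inv_metricE !freebD -scalerDr opprD addrACA. Qed.

Lemma inv_metric_basis i j : inv_metric (tens (s_ i) (s_ j)) = gup i j *: 1.
Proof.
rewrite inv_metricE !tensE !bvecE /gup [mx22 _ _ _ _ _ _]mxE.
by elim/ord2P: i; elim/ord2P: j; rewrite /= !(mulr0n, mulr1n) !mx22E;
  congr mx22; ring.
Qed.

Lemma slice_qmetric0 : slice qmetric 0 = 'i *: s_ 1.
Proof.
apply/ffunP => k; rewrite [LHS]ffunE /qmetric !freebZ freebD freebN !tensE !bvecE.
by rewrite /= mulr1 mulr0 subr0.
Qed.

Lemma slice_qmetric1 : slice qmetric 1 = - 'i *: s_ 0.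
Proof.
apply/ffunP => k; rewrite [LHS]ffunE /qmetric !freebZ freebD freebN !tensE !bvecE.
by rewrite /= mulr1 mulr0 sub0r scalerN scaleNr.
Qed.

(* ((w, ) (x) id) g = w = (id (x) ( , w)) g *)
Lemma qmetric_inverse_l w :
  tlift (fun v u => lact (inv_metric (tens w v)) u) qmetric = w.
Proof.
rewrite /tlift sum2 slice_qmetric0 slice_qmetric1; apply/ffunP => k.
rewrite freebD !lactE !inv_metricE !tensE !freebZ !bvecE.
have h := i2; elim/ord2P: k => /=; move: (w 0) (w 1);
  elim/mx22_ind => u1 u2 u3 u4; elim/mx22_ind => v1 v2 v3 v4;
  by rewrite !(mulr0n, mulr1n) !mx22E; congr mx22; ring: h.
Qed.

Lemma qmetric_inverse_r w :
  tlift (fun v u => ract v (inv_metric (tens u w))) qmetric = w.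
Proof.
rewrite /tlift sum2 slice_qmetric0 slice_qmetric1; apply/ffunP => k.
rewrite freebD !ractE !inv_metricE !tensE !freebZ !bvecE.
have h := i2; elim/ord2P: k => /=; move: (w 0) (w 1);
  elim/mx22_ind => u1 u2 u3 u4; elim/mx22_ind => v1 v2 v3 v4;
  by rewrite !(mulr0n, mulr1n) !mx22E; congr mx22; ring: h.
Qed.

Lemma nabla_bvec i : nabla (s_ i) = tens (2 *: theta) (s_ i).
Proof.
apply/ffunP => -[k l]; rewrite nablaE tensE freebZ !bvecE d0E.
case: (i == l); rewrite !(mulr1, mulr0, mul1r, mul0r) subrr addr0 //.
by rewrite scaler0.
Qed.

Lemma nablaD w v : nabla (w + v) = nabla w + nabla v.
Proof.
apply/ffunP => -[i j]; rewrite freebD !nablaE freebD d0D freebD mulrDl.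
by rewrite scalerDr addrACA.
Qed.

Lemma nabla_lact a w : nabla (lact a w) = lact a (nabla w) + tens (d0 a) w.
Proof.
apply/ffunP => -[i j]; rewrite freebD lactE tensE !nablaE lactE d0ME.
rewrite mulrDr -scalerAr mulrA -!addrA; congr (_ + _).
exact: addrC.
Qed.

Lemma nabla_ract w a :
  nabla (ract w a) = ract (nabla w) a + braid (tens w (d0 a)).
Proof.
apply/ffunP => -[i j]; rewrite freebD ractE braidE tensE !nablaE ractE !d0E.
move: (w j) (theta i) => u t.
elim/mx22_ind: u => u1 u2 u3 u4; elim/mx22_ind: t => t1 t2 t3 t4.
elim/mx22_ind: a => a1 a2 a3 a4; rewrite !mx22E; congr mx22; ring.
Qed.

Lemma torsion_free w : wedge (nabla w) = d1 w.
Proof.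
apply/ffunP => -[]; rewrite wedgeE !nablaE d1E !d0E !thetaE /pauli /=.
move: (w 0) (w 1) => u v.
elim/mx22_ind: u => u1 u2 u3 u4; elim/mx22_ind: v => v1 v2 v3 v4.
rewrite /pauli1 /pauli2 !mx22E; have h := i2; have z := nz2.
congr mx22; field: h => //.
Qed.

Lemma tens_connE (J : finType) (N : freeb C J -> freeb C ('I_2 * J)%type) X i j k :
  tens_conn N X (i, j, k) =
  nabla (slice X k) (i, j) - \sum_l X (j, l) * N (bvec C l) (i, k).
Proof.
rewrite /tens_conn /tlift big_split /= [LHS]freebD; congr (_ + _).
  by have := tmaplE nabla X (i, j) k; rewrite /tmapl /tlift.
rewrite sum_ffunE -sumrN; apply: eq_bigr => l _.
by rewrite tmaplE braidE sliceE assoclE tensE sliceE.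
Qed.

Lemma qmetricE i j : qmetric (i, j) = 'i *:
  ((1 == i)%:R * (0 == j)%:R - (0 == i)%:R * (1 == j)%:R).
Proof. by rewrite /qmetric freebZ freebD freebN !tensE !bvecE. Qed.

Lemma metric_compatible : tens_conn nabla qmetric = 0.
Proof.
apply/ffunP => -[[i j] k]; rewrite tens_connE sum2 !nabla_bvec nablaE !tensE.
rewrite [(2 *: theta) i]freebZ d0E !sliceE !qmetricE !bvecE ffunE thetaE.
have h := i2; have z := nz2.
elim/ord2P: i; elim/ord2P: j; elim/ord2P: k; rewrite /pauli /= /pauli1 /pauli2;
  rewrite !(mulr0n, mulr1n) !mx22E; congr mx22; field: h => //.
Qed.

Lemma nabla_connection : left_connection nabla.
Proof. by split; [exact: nablaD | exact: nabla_lact]. Qed.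

Lemma braid_bimodule : bimodule_map braid.
Proof.
split=> [X Y|a X|X a]; apply/ffunP => -[i j].
- by rewrite freebD !braidE freebD opprD.
- by rewrite lactE !braidE lactE mulrN.
- by rewrite ractE !braidE ractE mulNr.
Qed.

Lemma d1D w v : d1 (w + v) = d1 w + d1 v.
Proof.
rewrite /d1 -big_split; apply: eq_bigr => i _.
by case: wedge_bimodule => wD _ _; rewrite freebD d0D tensDl wD lactDl addrACA.
Qed.

(* The formulas defining tens_conn and tens_curv are balanced, so that these *)
(* maps are the expected ones on every w (x) m.                              *)

Section Balanced.
Variables (J : finType) (N : freeb C J -> freeb C ('I_2 * J)%type).
Hypothesis connN : left_connection N.

Lemma balanced_lcomp (K : finType) (f : freeb C ('I_2 * 'I_2)%type -> freeb C K) :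
  bimodule_map f -> forall w a m,
  tmapl f (assocl (tens (ract w a) (N m))) + tens (f (tens w (d0 a))) m =
  tmapl f (assocl (tens w (N (lact a m)))).
Proof.
move=> fb w a m; rewrite (proj2 connN) tensDr assoclD tens_ract assocl_tens.
rewrite /tmapl (tliftD (tmapl_balanced _ fb)); congr (_ + _).
by rewrite -[RHS]/(tmapl f _) tmapl_tens.
Qed.

Lemma tens_conn_balanced : balanced
  (fun w m => tens (nabla w) m + tmapl braid (assocl (tens w (N m)))).
Proof.
have bD := tliftD (tmapl_balanced J braid_bimodule).
split=> [w v m|w m n|w a m].
- by rewrite nablaD !tensDl assoclD /tmapl bD addrACA.
- by rewrite (proj1 connN) !tensDr assoclD /tmapl bD addrACA.
- rewrite -(balanced_lcomp braid_bimodule) nabla_ract tensDl tens_ract.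
  by rewrite -addrA; congr (_ + _); exact: addrC.
Qed.

Lemma tens_conn_tens w m :
  tens_conn N (tens w m) = tens (nabla w) m + tmapl braid (assocl (tens w (N m))).
Proof. exact: (tliftE tens_conn_balanced). Qed.

Lemma tens_curv_balanced : balanced
  (fun w m => tens (d1 w) m - tmapl wedge (assocl (tens w (N m)))).
Proof.
have bD := tliftD (tmapl_balanced J wedge_bimodule).
split=> [w v m|w m n|w a m].
- by rewrite d1D !tensDl assoclD /tmapl bD opprD addrACA.
- by rewrite (proj1 connN) !tensDr assoclD /tmapl bD opprD addrACA.
- rewrite -(balanced_lcomp wedge_bimodule) d1_ract tensDl tens_ract.
  have -> : tens (- wedge (tens w (d0 a))) m = - tens (wedge (tens w (d0 a))) m.
    by apply/ffunP => -[i j]; rewrite freebN !tensE freebN mulNr.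
  by rewrite opprD -addrA; congr (_ + _); exact: addrC.
Qed.

Lemma tens_curv_tens w m :
  tens_curv N (tens w m) = tens (d1 w) m - tmapl wedge (assocl (tens w (N m))).
Proof. exact: (tliftE tens_curv_balanced). Qed.

End Balanced.

End Calculus.

Section Spinors.
Variable C : numClosedFieldType.
Variable eps : C.

Notation spinor := (freeb C 'I_2).

Definition e_ (a : 'I_2) : spinor := bvec C a.

(* Cl i a b is C^{i a}_b and Sp i a b is S^a_{i b}. *)
Definition Cl (i : 'I_2) : 'M[C]_2 :=
  if i == 0 then (sqrtC 2)^-1 *: pauli1 C else (eps / sqrtC 2) *: pauli3 C.

Definition Sp (i a b : 'I_2) : alg C :=
  ('i / 2 * (if i == 0 then mx22 1 eps (- eps) 1
             else mx22 1 (- eps) eps 1) a b) *: pauli C i.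

Definition clifford_act : freeb C ('I_2 * 'I_2)%type -> spinor :=
  lext (fun p => \sum_b Cl p.1 p.2 b *: e_ b).

(* nabla_S e^a = S^a_{i b} s^i (x) e^b, extended by the left Leibniz rule *)
Definition nablaS (psi : spinor) : freeb C ('I_2 * 'I_2)%type :=
  \sum_a (lact (psi a) (\sum_i \sum_b lact (Sp i a b) (tens (s_ C i) (e_ b)))
          + tens (d0 (psi a)) (e_ a)).

Definition dirac (psi : spinor) : spinor := clifford_act (nablaS psi).

(* ( , ) (x) id *)
Definition contract : freeb C ('I_2 * 'I_2 * 'I_2)%type -> spinor :=
  tlift (fun X psi => lact (inv_metric X) psi).

Definition spin_laplacian (psi : spinor) : spinor :=
  contract (tens_conn nablaS (nablaS psi)).

Definition spin_curvature (psi : spinor) : freeb C (unit * 'I_2)%type :=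
  tens_curv nablaS (nablaS psi).

(* phi is a bimodule automorphism of the spinor bimodule and act2 is the     *)
(* action of Omega^2 on spinors; the existence of act2 is what it means for  *)
(* the formula for (s^i /\ s^j) |> e^a to be well defined.                   *)
Definition clifford_relations (kappa : C) (phi : spinor -> spinor)
    (act2 : freeb C (unit * 'I_2)%type -> spinor) : Prop :=
  [/\ bimodule_automorphism phi, bimodule_map act2 &
      forall i j a, act2 (tens (wedge (tens (s_ C i) (s_ C j))) (e_ a)) =
        \sum_b \sum_c (Cl j a b * Cl i b c) *: phi (e_ c)
        - (kappa * gup C i j) *: e_ a].

Lemma nablaS_connection : left_connection nablaS.
Proof.
split=> [m n|b m].
  rewrite /nablaS -big_split; apply: eq_bigr => a _.
  by rewrite freebD lactDl d0D tensDl addrACA.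
rewrite /nablaS lact_sum.
have -> : tens (d0 b) m = \sum_a tens (d0 b) (lact (m a) (e_ a)).
  by rewrite -(balanced_sumr (@balanced_tens C _ _)) -bvec_decomp.
rewrite -big_split; apply: eq_bigr => a _.
rewrite lactE d0M tensDl tens_ract tens_lact -lactA [in RHS]lactDr -[RHS]addrA.
by congr (_ + _); exact: addrC.
Qed.

Lemma nablaS_basis a :
  nablaS (e_ a) = \sum_i \sum_b lact (Sp i a b) (tens (s_ C i) (e_ b)).
Proof.
rewrite /nablaS (bigD1 a) //= bvecE eqxx lact1.
have d01 : d0 1 = 0 :> freeb C 'I_2.
  by apply/ffunP => i; rewrite d0E [RHS]ffunE mulr1 mul1r subrr.
have d00 : d0 0 = 0 :> freeb C 'I_2.
  by apply/ffunP => i; rewrite d0E [RHS]ffunE mulr0 mul0r subrr.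
have t0 (m : spinor) : tens 0 m = 0 :> freeb C ('I_2 * 'I_2)%type.
  by apply/ffunP => -[i j]; rewrite tensE ![fun_of_fin 0 _]ffunE mul0r.
rewrite d01 t0 addr0 [X in _ + X]big1 ?addr0 // => b /negbTE nba.
by rewrite bvecE eq_sym nba lact0l d00 t0 addr0.
Qed.

Lemma clifford_act_bimodule : bimodule_map clifford_act.
Proof.
apply: lext_bimodule => a p; apply/ffunP => k.
rewrite lactE ractE sum_ffunE mulr_sumr mulr_suml; apply: eq_bigr => b _.
rewrite freebZ bvecE -scalerAr -scalerAl.
by case: (b == k); rewrite ?mulr1 ?mul1r ?mulr0 ?mul0r.
Qed.

Lemma contract_tens X psi : contract (tens X psi) = lact (inv_metric X) psi.
Proof.
rewrite /contract tliftE //; split=> [Y Z m|Y m n|Y a m].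
- by rewrite inv_metricD lactDl.
- exact: lactDr.
- by rewrite inv_metric_ract lactA.
Qed.

End Spinors.

(* Main.v *)
Require Import Defs.
From mathcomp Require Import all_boot all_order all_algebra ring.
From mathcomp Require Import complex reals.
Import Order.TTheory GRing.Theory Num.Theory.
Local Open Scope ring_scope.

(** Write L_i and R_i for left and right multiplication by theta_i, which is
    i/2 times sigma^i, so that the partial derivatives of the calculus are
    L_i - R_i.  The spinor connection coefficients turn out to be
    S_i = theta_i (1 + s_i J), where s_1 = 1, s_2 = -1 and J = i eps sigma^2
    acts on the spinor index.  The 1 in S_i cancels the - R_i of the partial
    derivative, and the components of the spinor connection become
    <<nabla_i = L_i + s_i R_i J>> ([nablaS_spinmx]).  As J commutes with all the
    L_i and R_i and satisfies J^2 = -1, everything follows from this formula.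

    Dirac operator.  It is k (P sigma^1 + eps Q sigma^3) with k^2 = -1/8, where P
    and Q act on the entries in A and the Pauli matrices on the spinor index.  As
    sigma^1 and sigma^3 anticommute, its square is
    k^2 (P^2 + Q^2 + eps [P, Q] sigma^3 sigma^1), which needs only the two
    identities [diracPP_QQ] and [diracPQ] in A ([dirac_sqE]).

    Laplacian and curvature.  On forms tensored with spinors the connection
    acts by L_i - s_i R_i J, the sign of J being reversed by the braiding, so
    the second covariant derivative is
    <<T_ij = (L_i - s_i R_i J)(L_j + s_j R_j J)>> ([hessianE]).  Its contraction
    with the antisymmetric inverse metric is the Laplacian,
    i (T_21 - T_12) ([spin_laplacianE]).  Since the Levi-Civita connection is
    torsion free, its exterior product is the curvature, i (T_11 + T_22) Vol
    ([tens_curv_hessian]).  On the diagonal the J-linear terms of T_ii cancel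
    and theta_i^2 = -1/4 leaves T_ii = -1/2, so R_S is multiplication by -i Vol
    ([spin_curvatureE]).

    Clifford relations.  The Clifford matrices satisfy
    2 C^j C^i = delta_ij + i g^ij J ([Cl_mul]).  With i <> j the product s^i s^j
    vanishes, which forces phi = 2 i J = -2 eps sigma^2; with i = j it is i Vol,
    which then forces Vol to act as J.  These choices do satisfy all the
    relations.  The coefficients of R_S are therefore - i J = eps sigma^2, and
    the Lichnerowicz formula is the comparison of the expressions found. *)

(** * Matrices acting on the spinor index *)

Section SpinorIndex.

Local Set Implicit Arguments.
Local Unset Strict Implicit.

Variable C : numClosedFieldType.

Local Notation spinor := {ffun 'I_2 -> 'M[C]_2}.

Implicit Types (M N : 'M[C]_2) (psi : spinor).

Lemma mull_scalar_mx c (a : 'M[C]_2) : c%:M * a = c *: a.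
Proof. exact: mul_scalar_mx. Qed.

Lemma mulr_scalar_mx c (a : 'M[C]_2) : a * c%:M = c *: a.
Proof. exact: mul_mx_scalar. Qed.

Lemma lact_scalar_mx c psi : lact c%:M psi = c *: psi.
Proof. by apply/ffunP => b; rewrite lactE freebZ mull_scalar_mx. Qed.

(** Row convention: [spinmx M] multiplies the row of components of a spinor by
    M on the right, so that composition reverses products ([spinmxM]). *)
Definition spinmx M : spinor -> spinor :=
  lext (fun a => \sum_b M a b *: e_ C b).

Lemma spinmxE M psi b : spinmx M psi b = \sum_a M a b *: psi a.
Proof.
rewrite sum_ffunE; apply: eq_bigr => a _.
rewrite lactE sum_ffunE (bigD1 b) //= big1 ?addr0 => [|c /negbTE ncb].
  by rewrite freebZ bvecE eqxx -scalerAr mulr1.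
by rewrite freebZ bvecE ncb scaler0.
Qed.

Lemma spinmx_e M a : spinmx M (e_ C a) = \sum_b M a b *: e_ C b.
Proof. exact: lext_bvec. Qed.

Lemma spinmx_basis M a b : spinmx M (e_ C a) b = (M a b)%:M.
Proof.
rewrite spinmxE (bigD1 a) //= big1 ?addr0 => [|c /negbTE nca].
  by rewrite bvecE eqxx -scalemx1.
by rewrite bvecE eq_sym nca scaler0.
Qed.

Lemma spinmx_bimodule M : bimodule_map (spinmx M).
Proof.
split=> [m n|a m|a m]; apply/ffunP => b.
- by rewrite freebD !spinmxE -big_split; apply: eq_bigr => c _; rewrite freebD scalerDr.
- by rewrite lactE !spinmxE mulr_sumr; apply: eq_bigr => c _; rewrite lactE scalerAr.
- by rewrite ractE !spinmxE mulr_suml; apply: eq_bigr => c _; rewrite ractE scalerAl.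
Qed.

Lemma spinmxM M N psi : spinmx N (spinmx M psi) = spinmx (M * N) psi.
Proof.
apply/ffunP => b; rewrite !spinmxE.
under eq_bigr => c _ do rewrite spinmxE scaler_sumr.
rewrite exchange_big; apply: eq_bigr => a _.
rewrite mxE scaler_suml; apply: eq_bigr => c _.
by rewrite scalerA mulrC.
Qed.

Lemma spinmxZ M c psi : spinmx M (c *: psi) = c *: spinmx M psi.
Proof.
apply/ffunP => b; rewrite freebZ !spinmxE scaler_sumr.
by apply: eq_bigr => a _; rewrite freebZ !scalerA mulrC.
Qed.

Lemma spinmxZl M c psi : spinmx (c *: M) psi = c *: spinmx M psi.
Proof.
apply/ffunP => b; rewrite freebZ !spinmxE scaler_sumr.
by apply: eq_bigr => a _; rewrite mxE scalerA.
Qed.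

Lemma spinmx_scalar c psi : spinmx c%:M psi = c *: psi.
Proof.
apply/ffunP => b; rewrite freebZ spinmxE (bigD1 b) //= big1 ?addr0 => [|a].
  by rewrite mxE eqxx.
by rewrite mxE => /negbTE ->; rewrite scale0r.
Qed.

(** Together with [sum_scalar_mx], this allows one to invert a matrix relation
    between vectors of a module, here the images of the basis spinors under an
    arbitrary bimodule map. *)
Lemma sum_mulmx (V : lmodType C) M N a (v : 'I_2 -> V) :
  \sum_b M a b *: (\sum_c N b c *: v c) = \sum_c (M * N) a c *: v c.
Proof.
under eq_bigr => b _ do rewrite scaler_sumr.
rewrite exchange_big; apply: eq_bigr => c _.
by rewrite mxE scaler_suml; apply: eq_bigr => b _; rewrite scalerA.
Qed.

Lemma sum_scalar_mx (V : lmodType C) c a (v : 'I_2 -> V) :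
  \sum_b (c%:M : 'M_2) a b *: v b = c *: v a.
Proof.
rewrite (bigD1 a) //= big1 ?addr0 => [|b]; first by rewrite mxE eqxx.
by rewrite mxE eq_sym => /negbTE ->; rewrite scale0r.
Qed.

Lemma clifford_actE eps X b :
  clifford_act (C:=C) eps X b = \sum_i \sum_a Cl eps i a b *: X (i, a).
Proof.
rewrite pair_bigA sum_ffunE; apply: eq_bigr => -[i a] _ /=.
rewrite lactE sum_ffunE (bigD1 b) //= big1 ?addr0 => [|c /negbTE ncb].
  by rewrite freebZ bvecE eqxx -scalerAr mulr1.
by rewrite freebZ bvecE ncb scaler0.
Qed.

Lemma contractE (X : {ffun 'I_2 * 'I_2 * 'I_2 -> 'M[C]_2}) (b : 'I_2) :
  contract X b = inv_metric (slice X b).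
Proof.
rewrite /contract /tlift sum_ffunE (bigD1 b) //= big1 ?addr0.
  by rewrite lactE bvecE eqxx mulr1.
by move=> c /negbTE ncb; rewrite lactE bvecE ncb mulr0.
Qed.

End SpinorIndex.

(** * The spinor connection *)

Section SpinorData.

Local Set Implicit Arguments.
Local Unset Strict Implicit.

Variables (C : numClosedFieldType) (eps : C).

Local Notation spinor := {ffun 'I_2 -> 'M[C]_2}.

Implicit Types psi : spinor.

(** This is i eps sigma^2 ([spinJ_pauli2]), a complex structure on the spinor
    index when eps squares to 1. *)
Definition spinJ : 'M[C]_2 := mx22 0 eps (- eps) 0.

Lemma spinJ_pauli2 : spinJ = ('i * eps) *: pauli2 C.
Proof.
by rewrite /spinJ /pauli2 mx22Z; have hi := i2 C; congr mx22; ring: hi.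
Qed.

Lemma nablaSE psi i b :
  nablaS eps psi (i, b) = \sum_a psi a * Sp eps i a b + d0 (psi b) i.
Proof.
rewrite /nablaS big_split freebD !sum_ffunE; congr (_ + _).
  apply: eq_bigr => a _; rewrite lactE; congr (_ * _).
  rewrite sum_ffunE (bigD1 i) //= sum_ffunE (bigD1 b) //=.
  rewrite lactE tensE !bvecE !eqxx !mulr1 big1 ?addr0 => [|c /negbTE ncb].
    rewrite big1 ?addr0 // => k /negbTE nki; rewrite sum_ffunE big1 // => c _.
    by rewrite lactE tensE bvecE nki mul0r mulr0.
  by rewrite lactE tensE !bvecE ncb !mulr0.
rewrite (bigD1 b) //= tensE bvecE eqxx mulr1 big1 ?addr0 // => a /negbTE nab.
by rewrite tensE bvecE nab mulr0.
Qed.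

(** Here (-1) ^+ i is s_i: the ordinals 0 and 1 stand for the indices 1 and 2,
    whence s_1 = 1 and s_2 = -1. *)
Lemma Sp_theta i a b :
  Sp eps i a b = ((a == b)%:R + (-1) ^+ i * spinJ a b) *: theta C i.
Proof.
rewrite thetaE scalerA /Sp; congr (_ *: _); rewrite [RHS]mulrC; congr (_ * _).
elim/ord2P: i; elim/ord2P: a; elim/ord2P: b;
  rewrite /spinJ !mxE /= ?expr0 ?expr1 ?mul1r ?mulN1r ?opprK ?oppr0;
  by rewrite ?addr0 ?add0r.
Qed.

(** The identity part of the connection coefficients adds psi_b theta_i, which
    is what the partial derivative of psi_b subtracts. *)
Lemma nablaS_spinmx psi i b : nablaS eps psi (i, b) =
  theta C i * psi b + (-1) ^+ i *: (spinmx spinJ psi b * theta C i).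
Proof.
rewrite nablaSE d0E spinmxE.
under eq_bigr => a _ do rewrite Sp_theta scalerDl mulrDr -!scalerAr -scalerA.
rewrite big_split /= (bigD1 b) //= eqxx scale1r big1 => [|a /negbTE nab].
  rewrite addr0 [LHS]addrC -addrA; congr (_ + _); rewrite addKr.
  rewrite mulr_suml scaler_sumr; apply: eq_bigr => a _.
  by rewrite -scalerAl.
by rewrite nab scale0r.
Qed.

Hypothesis eps2 : eps * eps = 1.

Lemma spinJ_sqr : spinJ * spinJ = (- 1)%:M.
Proof.
rewrite -scalemx1 -[1%:M]/(1 : 'M_2) /spinJ !mx22E.
by have h := eps2; congr mx22; ring: h.
Qed.

(** * The Dirac operator and its square *)

Lemma diracE psi b : dirac eps psi b =
  ('i / (2 * sqrtC 2)) *: \sum_a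
    (pauli1 C a b *: (pauli1 C * psi a + psi a * pauli2 C)
     + (eps * pauli3 C a b) *: (psi a * pauli1 C + pauli2 C * psi a)).
Proof.
have h := eps2; have z := nz2 C; have z' : sqrtC 2 != 0 :> C by rewrite sqrtC_eq0.
rewrite /dirac clifford_actE !sum2 !nablaS_spinmx !spinmxE !sum2 !thetaE /Cl /spinJ.
move: (psi 0) (psi 1); elim/mx22_ind => u1 u2 u3 u4; elim/mx22_ind => v1 v2 v3 v4.
elim/ord2P: b; rewrite /pauli /= /pauli1 /pauli2 /pauli3 !mx22Z;
  rewrite ![mx22 _ _ _ _ _ _]mxE /= ?expr0 ?expr1 !mx22E; congr mx22; field: h => //.
Qed.

(** The entries of the Dirac operator are assembled from this map, which
    multiplies sigma^1 on the spinor index, and from [diracQ], which multiplies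
    eps sigma^3. *)
Definition diracP (a : 'M[C]_2) : 'M[C]_2 := pauli1 C * a + a * pauli2 C.

Definition diracQ (a : 'M[C]_2) : 'M[C]_2 := a * pauli1 C + pauli2 C * a.

Lemma diracP_lin c d a b :
  diracP (c *: (a + d *: b)) = c *: (diracP a + d *: diracP b).
Proof.
rewrite /diracP -scalerAl -!scalerAr -scalerDr mulrDl mulrDr -scalerAl -scalerAr.
by rewrite addrACA -scalerDr.
Qed.

Lemma diracQ_lin c d a b :
  diracQ (c *: (a + d *: b)) = c *: (diracQ a + d *: diracQ b).
Proof.
rewrite /diracQ -scalerAl -!scalerAr -scalerDr mulrDl mulrDr -scalerAl -scalerAr.
by rewrite addrACA -scalerDr.
Qed.

Lemma diracPP_QQ a : diracP (diracP a) + diracQ (diracQ a) =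
  4 *: a + 2 *: (pauli1 C * a * pauli2 C + pauli2 C * a * pauli1 C).
Proof.
have hi := i2 C; rewrite /diracP /diracQ /pauli1 /pauli2.
by elim/mx22_ind: a => u1 u2 u3 u4; rewrite !mx22E; congr mx22; ring: hi.
Qed.

(** The mixed products, of a left and a right multiplication, cancel in the
    commutator; [sigma^1, sigma^2] = 2 i sigma^3 remains on either side. *)
Lemma diracPQ a : diracP (diracQ a) - diracQ (diracP a) =
  (2 * 'i) *: (pauli3 C * a + a * pauli3 C).
Proof.
have hi := i2 C; rewrite /diracP /diracQ /pauli1 /pauli2 /pauli3.
by elim/mx22_ind: a => u1 u2 u3 u4; rewrite !mx22E; congr mx22; ring: hi.
Qed.

Lemma dirac_sqE psi b : dirac eps (dirac eps psi) b =
  - (1 / 2) *: psi b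
  - (1 / 4) *: (pauli1 C * psi b * pauli2 C + pauli2 C * psi b * pauli1 C)
  + \sum_a (eps / 4 * pauli2 C a b) *: (pauli3 C * psi a + psi a * pauli3 C).
Proof.
have h := eps2; have hi := i2 C.
set k : C := 'i / (2 * sqrtC 2).
have kk : k * k = - (1 / 8).
  rewrite /k mulrACA -invfM mulrACA -[sqrtC 2 * _]expr2 sqrtCK hi mulN1r div1r.
  by congr (- _^-1); ring.
have D0 m : dirac eps m 0 = k *: (diracP (m 1) + eps *: diracQ (m 0)).
  rewrite diracE sum2 /pauli1 /pauli3 !mxE /= mulr1 mulr0 !scale0r scale1r.
  by rewrite add0r addr0 addrC.
have D1 m : dirac eps m 1 = k *: (diracP (m 0) + - eps *: diracQ (m 1)).
  rewrite diracE sum2 /pauli1 /pauli3 !mxE /= mulrN1 mulr0 !scale0r scale1r.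
  by rewrite add0r addr0.
(* The two components of the square differ by the sign of eps only: c is eps
   in the first one, - eps in the second. *)
have sq c e (x y x' y' : 'M[C]_2) : c * c = 1 -> e = - c ->
    k *: (k *: (x + e *: y) + c *: (k *: (y' + c *: x'))) =
    - (1 / 8) *: (x + x' - c *: (y - y')).
  move=> cc ->; rewrite -kk; apply/matrixP => i j; rewrite !mxE; ring: cc.
elim/ord2P: b; rewrite !(D0, D1) diracP_lin diracQ_lin.
- rewrite (sq eps (- eps)) // diracPP_QQ diracPQ sum2 /pauli2 !mxE /=.
  rewrite !mulr0 scale0r add0r.
  by apply/matrixP => i j; rewrite !mxE; field.
- rewrite (sq (- eps) eps) ?mulrNN ?opprK // diracPP_QQ diracPQ sum2 /pauli2 !mxE /=.
  rewrite !mulr0 scale0r addr0.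
  by apply/matrixP => i j; rewrite !mxE; field.
Qed.

(** * The second covariant derivative *)

Lemma theta_mul i : theta C i * theta C i = - (1 / 4) *: 1.
Proof.
have z := nz2 C; have hi := i2 C; rewrite thetaE.
elim/ord2P: i; rewrite /pauli /= /pauli1 /pauli2 !mx22E; congr mx22; field: hi => //.
Qed.

Lemma sum_nablaS_basis (m : spinor) i b :
  \sum_l m l * nablaS eps (e_ C l) (i, b) =
  m b * theta C i + (-1) ^+ i *: (spinmx spinJ m b * theta C i).
Proof.
under eq_bigr => l _ do rewrite nablaS_spinmx spinmx_basis bvecE mulrDr.
rewrite big_split /= (bigD1 b) //= eqxx mulr1 big1 ?addr0 => [|l /negbTE nlb].
  congr (_ + _); rewrite spinmxE mulr_suml scaler_sumr; apply: eq_bigr => l _.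
  by rewrite -scalerAr mulrA mulr_scalar_mx.
by rewrite nlb !mulr0.
Qed.

Definition row_of (X : {ffun 'I_2 * 'I_2 -> 'M[C]_2}) j : spinor :=
  [ffun l => X (j, l)].

(** The Levi-Civita connection acts by 2 R_i + (L_i - R_i) = L_i + R_i on the
    coefficients, and the braiding subtracts right multiplication by S_i, which is
    R_i + s_i R_i J: this leaves L_i and reverses the sign of J. *)
Lemma tens_conn_nablaS X i j b : tens_conn (nablaS eps) X (i, j, b) =
  theta C i * X (j, b) - (-1) ^+ i *: (spinmx spinJ (row_of X j) b * theta C i).
Proof.
rewrite tens_connE nablaE d0E sliceE.
have -> : \sum_l X (j, l) * nablaS eps (bvec C l) (i, b) =
  \sum_l row_of X j l * nablaS eps (e_ C l) (i, b).
  by apply: eq_bigr => l _; rewrite ffunE.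
rewrite sum_nablaS_basis ffunE scaler_nat mulr2n.
move: (X _ * _) (theta C i * _) => u v; rewrite opprD addrA; congr (_ - _).
by rewrite addrACA subrr addr0 addrAC subrr add0r.
Qed.

(** Expansion of (L_i - s_i R_i J)(L_j + s_j R_j J), the second term coming
    from J^2 = -1. *)
Lemma hessianE psi i j b :
  tens_conn (nablaS eps) (nablaS eps psi) (i, j, b) =
  theta C i * theta C j * psi b
  + (-1) ^+ (i + j) *: (psi b * theta C j * theta C i)
  + (-1) ^+ j *: (theta C i * spinmx spinJ psi b * theta C j)
  - (-1) ^+ i *: (theta C j * spinmx spinJ psi b * theta C i).
Proof.
rewrite tens_conn_nablaS.
have -> : row_of (nablaS eps psi) j =
    lact (theta C j) psi + (-1) ^+ j *: ract (spinmx spinJ psi) (theta C j).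
  by apply/ffunP => l; rewrite freebD freebZ lactE ractE ffunE nablaS_spinmx.
have [JD JL JR] := spinmx_bimodule spinJ.
rewrite nablaS_spinmx JD spinmxZ JL JR spinmxM spinJ_sqr spinmx_scalar.
rewrite freebD freebZ lactE ractE freebZ scaleN1r.
rewrite mulrDr -scalerAr !mulrA mulrDl -scalerAl scalerDr scalerA -exprD mulNr.
rewrite mulNr scalerN opprD opprK.
rewrite -addrA -[RHS]addrA -[RHS]addrA; congr (_ + _).
by rewrite [LHS]addrA [LHS]addrC.
Qed.

(** The inverse metric is antisymmetric, so only the commutator of theta_1 and
    theta_2 survives among the J-free terms, and it gives sigma^3. *)
Lemma spin_laplacianE psi b : spin_laplacian eps psi b =
  - (1 / 2) *: (pauli3 C * psi b + psi b * pauli3 C)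
  + \sum_a (eps / 2 * pauli2 C a b) *:
      (pauli2 C * psi a * pauli1 C + pauli1 C * psi a * pauli2 C).
Proof.
have hi := i2 C; have z := nz2 C.
rewrite /spin_laplacian contractE inv_metricE !sliceE !hessianE /=.
rewrite addn0 expr0 expr1 !thetaE.
have -> : \sum_a (eps / 2 * pauli2 C a b) *:
      (pauli2 C * psi a * pauli1 C + pauli1 C * psi a * pauli2 C) =
    - ('i / 2) *: (pauli2 C * spinmx spinJ psi b * pauli1 C
                   + pauli1 C * spinmx spinJ psi b * pauli2 C).
  rewrite spinmxE !mulr_sumr !mulr_suml -big_split scaler_sumr.
  apply: eq_bigr => a _; rewrite /= -!scalerAr -!scalerAl -scalerDr scalerA.
  congr (_ *: _); rewrite /pauli2 /spinJ.
  by elim/ord2P: a; elim/ord2P: b; rewrite !mxE /=; field: hi.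
move: (psi b) (spinmx _ _ _); elim/mx22_ind => u1 u2 u3 u4; elim/mx22_ind => v1 v2 v3 v4.
rewrite /pauli /pauli1 /pauli2 /pauli3 /= !mx22E; congr mx22; field: hi => //.
Qed.

(** The curvature is the exterior product of the second covariant derivative:
    the exterior product carries the Levi-Civita connection to d by torsion
    freeness and reverses sign under the braiding. *)
Lemma tens_curv_hessian (N : spinor -> {ffun 'I_2 * 'I_2 -> 'M[C]_2}) X b :
  tens_curv N X (tt, b) = 'i *: \sum_i tens_conn N X (i, i, b).
Proof.
have -> : tens_curv N X (tt, b) =
    d1 (slice X b) tt - \sum_l 'i *: \sum_i X (i, l) * N (e_ C l) (i, b).
  rewrite /tens_curv /tlift big_split /= [LHS]freebD; congr (_ + _).
    by have := tmaplE (@d1 C) X tt b; rewrite /tmapl /tlift.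
  rewrite sum_ffunE -sumrN; apply: eq_bigr => l _.
  by rewrite freebN tmaplE wedgeE !sliceE !assoclE !tensE !sliceE sum2.
have -> : d1 (slice X b) tt = 'i *: \sum_i nabla (slice X b) (i, i).
  by rewrite -torsion_free wedgeE sum2.
rewrite -scaler_sumr exchange_big -scalerBr -sumrB; congr (_ *: _).
by apply: eq_bigr => i _; rewrite tens_connE.
Qed.

Lemma spin_curvatureE psi :
  spin_curvature eps psi = tens (lact (- 'i)%:M (Vol C)) psi.
Proof.
apply/ffunP => -[[] b]; rewrite tensE lactE !bvecE mulr1 tens_curv_hessian.
rewrite (eq_bigr (fun _ => - (1 / 2) *: psi b)); last first.
  move=> i _; rewrite hessianE addrK -[psi b * _ * _]mulrA !theta_mul.
  rewrite -scalerAl -scalerAr.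
  rewrite !mul1r !mulr1 addnn -mul2n exprM sqrrN !expr1n scale1r -scalerDl.
  by congr (_ *: _); field.
rewrite sumr_const card_ord -scaler_nat !scalerA mull_scalar_mx.
by congr (_ *: _); field.
Qed.

(** * The Clifford relations *)

(** This rewriting of the Clifford matrices is what makes the relations
    solvable: the off-diagonal products are multiples of J with coefficient
    proportional to the metric. *)
Lemma Cl_mul i j : Cl eps j * Cl eps i =
  (1 / 2) *: ((i == j)%:R%:M + ('i * gup C i j) *: spinJ).
Proof.
have h := eps2; have hi := i2 C.
have s2 : (sqrtC 2)^-1 * (sqrtC 2)^-1 = 1 / 2 :> C.
  by rewrite -invfM -expr2 sqrtCK div1r.
rewrite -scalemx1 -[1%:M]/(1 : 'M_2) /spinJ /gup /Cl.
rewrite -s2; move: (sqrtC 2)^-1 => r.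
elim/ord2P: i; elim/ord2P: j; rewrite /= ![mx22 _ _ _ _ _ _]mxE /=;
  by rewrite /pauli1 /pauli3 !mx22E; congr mx22; ring: h hi.
Qed.

Lemma clifford_sum i j a (v : 'I_2 -> spinor) :
  \sum_b \sum_c (Cl eps j a b * Cl eps i b c) *: v c =
  (1 / 2) *: ((i == j)%:R *: v a + ('i * gup C i j) *: \sum_c spinJ a c *: v c).
Proof.
transitivity (\sum_c (Cl eps j * Cl eps i) a c *: v c).
  rewrite -sum_mulmx; apply: eq_bigr => b _; rewrite scaler_sumr.
  by apply: eq_bigr => c _; rewrite scalerA.
rewrite Cl_mul -(sum_scalar_mx _ a v) scaler_sumr -big_split scaler_sumr.
apply: eq_bigr => c _ /=.
have E (x y : 'M[C]_2) k l : (k *: (x + l *: y)) a c = k * (x a c + l * y a c).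
  by rewrite !mxE.
by rewrite E -scalerA scalerDl scalerA.
Qed.

(** The only candidate, as [clifford_unique] forces Vol to act as J. *)
Definition vol_act (X : {ffun unit * 'I_2 -> 'M[C]_2}) : spinor :=
  spinmx spinJ [ffun b => X (tt, b)].

Lemma vol_act_bimodule : bimodule_map vol_act.
Proof.
have [JD JL JR] := spinmx_bimodule spinJ.
rewrite /vol_act; split=> [X Y|a X|a X]; rewrite -1?JD -1?JL -1?JR;
  by congr spinmx; apply/ffunP => b; rewrite !ffunE.
Qed.

Lemma vol_act_tens w m : vol_act (tens w m) = spinmx spinJ (lact (w tt) m).
Proof. by congr spinmx; apply/ffunP => b; rewrite ffunE tensE lactE. Qed.

Lemma clifford_relations_exist :
  clifford_relations eps 1 (spinmx ((2 * 'i) *: spinJ)) vol_act.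
Proof.
have hi := i2 C; have z := nz2 C.
have i0 : 'i != 0 :> C by exact: neq0Ci.
split.
- split; first exact: spinmx_bimodule.
  exists (spinmx (- (2 * 'i)^-1 *: spinJ)) => m; rewrite spinmxM;
    rewrite -scalerAl -scalerAr spinJ_sqr scalerA scale_scalar_mx spinmx_scalar;
    rewrite -[RHS]scale1r; congr (_ *: _); field; by rewrite ?i0.
- exact: vol_act_bimodule.
move=> i j a; rewrite clifford_sum mul1r.
under [X in _ *: (_ + _ *: X)]eq_bigr => c _ do rewrite spinmx_e.
rewrite sum_mulmx -spinmx_e -scalerAr spinJ_sqr scale_scalar_mx spinmx_scalar.
rewrite wedge_basis vol_act_tens scalerDr !scalerA.
rewrite -[LHS]addr0 -[RHS]addrA -scalerBl; congr (_ + _).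
  case: eqP => _; last first.
    by rewrite ffunE lact0l mulr0 scale0r -(scale0r (e_ C a)) spinmxZ !scale0r.
  rewrite freebZ bvecE eqxx scalemx1 lact_scalar_mx spinmxZ spinmxZl scalerA.
  by congr (_ *: _); rewrite /=; field.
by rewrite (_ : _ - _ = 0) ?scale0r //; field: hi.
Qed.

(** The relation for s^1 s^2 = 0 reads phi J = - 2 i on the basis, which
    determines phi because J is invertible; the relation for s^1 s^1 = i Vol then
    says that - i Vol acts as - phi / 2. *)
Lemma clifford_unique phi act2 : clifford_relations eps 1 phi act2 ->
  (forall a, phi (e_ C a) = spinmx ((2 * 'i) *: spinJ) (e_ C a)) /\
  (forall a, act2 (tens (lact (- 'i)%:M (Vol C)) (e_ C a)) =
     - 'i *: spinmx spinJ (e_ C a)).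
Proof.
have hi := i2 C; have z := nz2 C.
move=> [_ [aD aL _] rel].
have act0 : act2 0 = 0 by apply: (addrI (act2 0)); rewrite -aD !addr0.
have phiE a : phi (e_ C a) = spinmx ((2 * 'i) *: spinJ) (e_ C a).
  (* the relation at indices 0 and 1 of 'I_2, doubled *)
  have relJ c : \sum_d spinJ c d *: phi (e_ C d) = (- 2 * 'i) *: e_ C c.
    have := rel 0 1 c.
    rewrite clifford_sum wedge_basis /= (_ : tens 0 _ = 0); last first.
      by apply/ffunP => -[u b]; rewrite tensE !ffunE mul0r.
    rewrite act0 scale0r add0r /gup mxE /= mul1r mulrN hi opprK scale1r.
    move/esym/eqP; rewrite subr_eq0 => /eqP/(congr1 ( *:%R 2)).
    by rewrite !scalerA mul1r divff // scale1r mulrN mulNr.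
  rewrite spinmx_e.
  have -> : phi (e_ C a) = - \sum_c (spinJ * spinJ) a c *: phi (e_ C c).
    by rewrite spinJ_sqr sum_scalar_mx scaleN1r opprK.
  rewrite -sum_mulmx -sumrN; apply: eq_bigr => c _.
  rewrite relJ scalerA -scaleNr [in RHS]mxE; congr (_ *: _); ring.
split=> // a.
have := rel 0 0 a.
rewrite clifford_sum wedge_basis /= /gup mxE /= !mulr0 !scale0r subr0 addr0 scale1r.
rewrite phiE spinmxZl scalerA => relV.
have -> : tens (lact (- 'i)%:M (Vol C)) (e_ C a) =
    lact (- 1)%:M (tens ('i *: Vol C) (e_ C a)).
  apply/ffunP => -[u b]; rewrite lactE !tensE lactE freebZ !mull_scalar_mx.
  by rewrite scaleN1r scaleNr mulNr.
rewrite aL relV lact_scalar_mx scalerA; congr (_ *: _); field => //.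
Qed.

Lemma spin_curvature_coef a b :
  (- 'i *: spinmx spinJ (e_ C a)) b = (eps * pauli2 C a b)%:M.
Proof.
have hi := i2 C.
by rewrite freebZ spinmx_basis scale_scalar_mx spinJ_pauli2 mxE;
  congr (_%:M); ring: hi.
Qed.

(** * The Lichnerowicz formula *)

Lemma lichnerowicz psi b :
  \sum_a dirac eps (dirac eps psi) a * (- 2 * eps * pauli2 C a b)%:M =
  spin_laplacian eps psi b + \sum_a psi a * (eps * pauli2 C a b)%:M.
Proof.
have hi := i2 C; have z := nz2 C; have h := eps2.
rewrite spin_laplacianE !sum2 !dirac_sqE !sum2 !mulr_scalar_mx.
rewrite ![pauli2 C * _ * pauli1 C + _]addrC.
(* The identity is linear in psi, {sigma^3, psi} and the mixed term of
   sigma^1 and sigma^2, taken as independent unknowns. *)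
elim/ord2P: b; move: (psi 0) (psi 1)
  (pauli3 C * psi 0 + _) (pauli3 C * psi 1 + _)
  (pauli1 C * psi 0 * _ + _) (pauli1 C * psi 1 * _ + _) => p0 p1 t0 t1 s0 s1;
  rewrite /pauli2; apply/matrixP => i j; rewrite !mxE /=; field: h hi => //.
Qed.

End SpinorData.

Theorem proposition4p10 (R : realType) (eps : R[i])
    (heps : eps = 1 \/ eps = -1) :
  [/\ (forall (psi : {ffun 'I_2 -> 'M[R[i]]_2}) (b : 'I_2),
        dirac eps psi b =
        ('i / (2 * sqrtC 2)) *: \sum_a
          (pauli1 R[i] a b *: (pauli1 R[i] * psi a + psi a * pauli2 R[i])
           + (eps * pauli3 R[i] a b) *:
               (psi a * pauli1 R[i] + pauli2 R[i] * psi a))),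
      (forall (psi : {ffun 'I_2 -> 'M[R[i]]_2}) (b : 'I_2),
        dirac eps (dirac eps psi) b =
        - (1 / 2) *: psi b
        - (1 / 4) *: (pauli1 R[i] * psi b * pauli2 R[i]
                      + pauli2 R[i] * psi b * pauli1 R[i])
        + \sum_a (eps / 4 * pauli2 R[i] a b) *:
            (pauli3 R[i] * psi a + psi a * pauli3 R[i])),
      (forall (psi : {ffun 'I_2 -> 'M[R[i]]_2}) (b : 'I_2),
        spin_laplacian eps psi b =
        - (1 / 2) *: (pauli3 R[i] * psi b + psi b * pauli3 R[i])
        + \sum_a (eps / 2 * pauli2 R[i] a b) *:
            (pauli2 R[i] * psi a * pauli1 R[i]
             + pauli1 R[i] * psi a * pauli2 R[i])),
      (exists (phi : {ffun 'I_2 -> 'M[R[i]]_2} -> {ffun 'I_2 -> 'M[R[i]]_2})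
              (act2 : {ffun unit * 'I_2 -> 'M[R[i]]_2} ->
                      {ffun 'I_2 -> 'M[R[i]]_2}),
        clifford_relations eps 1 phi act2) &
      (forall (kappa : R[i])
              (phi : {ffun 'I_2 -> 'M[R[i]]_2} -> {ffun 'I_2 -> 'M[R[i]]_2})
              (act2 : {ffun unit * 'I_2 -> 'M[R[i]]_2} ->
                      {ffun 'I_2 -> 'M[R[i]]_2}),
        kappa = 1 -> clifford_relations eps kappa phi act2 ->
        [/\ (forall a b : 'I_2,
               phi (e_ R[i] a) b = (- 2 * eps * pauli2 R[i] a b)%:M),
            (forall a b : 'I_2,
               act2 (spin_curvature eps (e_ R[i] a)) b =
               (eps * pauli2 R[i] a b)%:M) &
            (forall (psi : {ffun 'I_2 -> 'M[R[i]]_2}) (b : 'I_2),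
               \sum_a dirac eps (dirac eps psi) a * phi (e_ R[i] a) b =
               kappa *: spin_laplacian eps psi b
               + \sum_a psi a * act2 (spin_curvature eps (e_ R[i] a)) b)])].
Proof.
have eps2 : eps * eps = 1 by case: heps => ->; rewrite ?mulr1 ?mulrNN ?mulr1.
split.
- exact: diracE.
- exact: dirac_sqE.
- exact: spin_laplacianE.
- by do 2 eexists; exact: clifford_relations_exist.
move=> kappa phi act2 -> rel; have [phiE volE] := clifford_unique eps2 rel.
have phib a b : phi (e_ _ a) b = (- 2 * eps * pauli2 _ a b)%:M.
  have hi := i2 R[i].
  rewrite phiE spinmx_basis spinJ_pauli2 !mxE; congr (_%:M); ring: hi.
have curvb a b : act2 (spin_curvature eps (e_ _ a)) b = (eps * pauli2 _ a b)%:M.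
  by rewrite spin_curvatureE // volE spin_curvature_coef.
split=> // psi b; rewrite scale1r.
under eq_bigr => a _ do rewrite phib.
under [in RHS]eq_bigr => a _ do rewrite curvb.
exact: lichnerowicz.
Qed.
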